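(* The functor $\mathcal{R}^\downarrow:\mathbf{FR}\to\mathbf{RIO}$, from the category of regular connective foliations to the category of clear and distinct connective representations with integral object, is left adjoint to the functor $\Phi_\kappa:\mathbf{RIO}\to\mathbf{FR}$: $$\mathcal{R}^\downarrow\dashv\Phi_\kappa .$$
   Context: A connective space $X=(|X|,\kappa(X))$ is a set $|X|$ with a set $\kappa(X)$ of subsets of $|X|$ (the connected subsets; $\kappa(X)$ is called a connective structure on $|X|$) such that $\emptyset\in\kappa(X)$ and the union of every nonempty family of members of $\kappa(X)$ with nonempty intersection belongs to $\kappa(X)$. A connective morphism $f:X\to Y$ is a map $|X|\to|Y|$ with $f(K)\in\kappa(Y)$ for all $K\in\kappa(X)$. $X$ is integral if $\{x\}\in\kappa(X)$ for every $x\in|X|$. The connected components of $X$ are its maximal nonempty connected subsets. For a set $\mathcal{A}$ of subsets of a set, $[\mathcal{A}]_0$ is the smallest connective structure containing $\mathcal{A}$. Representations. A (connective) representation $\rho:A\rightsquigarrow B$ of a connective space $A$ in a connective space $B$ is a map $\rho$ from $|A|$ to the set of nonempty subsets of $|B|$ such that $\bigcup_{a\in K}\rho(a)\in\kappa(B)$ for every $K\in\kappa(A)$. One writes $ob(\rho)=A$ (object of $\rho$) and $sp(\rho)=B$ (space of $\rho$). $\rho$ is clear if for every $S\subset|A|$ with $S\notin\kappa(A)$ one has $\bigcup_{a\in S}\rho(a)\notin\kappa(B)$; it is distinct if $\rho(a)\cap\rho(a')=\emptyset$ whenever $a\ne a'$. A morphism of representations from $\rho:A\rightsquigarrow B$ to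 $\rho':A'\rightsquigarrow B'$ is a pair $(\alpha,\beta)$ of connective morphisms $\alpha:A\to A'$, $\beta:B\to B'$ such that $\beta(\rho(a))\subset\rho'(\alpha(a))$ for all $a\in|A|$. $\mathbf{RIO}$ is the category whose objects are the clear and distinct representations $\rho$ with $ob(\rho)$ integral, and whose morphisms are all morphisms of representations between them. Foliations. A connective foliation is a triple $Z=(|Z|,\kappa_0(Z),\kappa_1(Z))$ with $\kappa_0(Z)$ (internal) and $\kappa_1(Z)$ (external) connective structures on the set $|Z|$; put $Z_i=(|Z|,\kappa_i(Z))$. It is regular if $\kappa_0(Z)\subset\kappa_1(Z)$. A morphism of foliations $Z\to Z'$ is a map $|Z|\to|Z'|$ that is a connective morphism $Z_i\to Z'_i$ for $i=0$ and $i=1$. $\mathbf{FR}$ is the category of regular connective foliations with all morphisms of foliations. The leaves of $Z$ are the (nonempty) connected components of $Z_0$. The induced space of leaves $Z^\downarrow$ is the connective space whose points are the leaves of $Z$, a set $\mathcal{A}$ of leaves being connected iff $\bigcup_{F\in\mathcal{A}}F\in\kappa_1(Z)$. The functor $\mathcal{R}^\downarrow$. On objects, $\mathcal{R}^\downarrow(Z):Z^\downarrow\rightsquigarrow Z_1$ is the representation $F\mapsto F\subset|Z|$. On a morphism $\phi:Z\to Z'$, $\mathcal{R}^\downarrow(\phi)=(\phi_0,\phi_1)$ where $\phi_0(F)$ is the leaf of $Z'$ containing $\phi(F)$, and $\phi_1:Z_1\to Z'_1$ coincides with $\phi$ as a map. The functor $\Phi_\kappa$. On objects, for $\rho:A\rightsquigarrow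 B$, $\Phi_\kappa(\rho)$ is the foliation with support $|B|$, external structure $\kappa(B)$, and internal structure $\big[\bigcup_{a\in|A|}\{K\in\kappa(B): K\subset\rho(a)\}\big]_0$. On morphisms, $\Phi_\kappa(\alpha,\beta)=\beta$. *)

(* Defs.v *)
From mathcomp Require Import all_boot.
From mathcomp Require Import mathcomp_extra boolp classical_sets.

Set Implicit Arguments.
Unset Strict Implicit.
Unset Printing Implicit Defensive.

Local Open Scope classical_set_scope.

Record category := Category {
  obj :> Type;
  hom : obj -> obj -> Type;
  idm : forall X, hom X X;
  comp : forall X Y Z, hom Y Z -> hom X Y -> hom X Z;
  comp_idl : forall X Y (f : hom X Y), comp (idm Y) f = f;
  comp_idr : forall X Y (f : hom X Y), comp f (idm X) = f;
  compA : forall X Y Z W (h : hom Z W) (g : hom Y Z) (f : hom X Y),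
    comp h (comp g f) = comp (comp h g) f }.

Arguments hom {c} X Y.
Arguments idm {c} X.
Arguments comp {c X Y Z} g f.

Record functor (C D : category) := Functor {
  fobj :> C -> D;
  fmap : forall X Y : C, hom X Y -> hom (fobj X) (fobj Y);
  fmap_id : forall X : C, fmap (idm X) = idm (fobj X);
  fmap_comp : forall (X Y Z : C) (g : hom Y Z) (f : hom X Y),
    fmap (comp g f) = comp (fmap g) (fmap f) }.

Arguments fmap {C D} f0 {X Y} f.

(* [left_adjoint F G] is F -| G. *)
Definition left_adjoint (C D : category) (F : functor C D) (G : functor D C)
    : Prop :=
  exists Phi : forall (X : C) (Y : D), hom (F X) Y -> hom X (G Y),
    (forall X Y, bijective (Phi X Y)) /\
    (forall (X X' : C) (Y Y' : D) (h : hom X' X) (k : hom Y Y')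
            (f : hom (F X) Y),
       Phi X' Y' (comp k (comp f (fmap F h)))
       = comp (fmap G k) (comp (Phi X Y f) h)).

Definition full_subcategory (C : category) (P : C -> Prop) : category :=
  {| obj := {X : C | P X};
     hom := fun X Y => hom (sval X) (sval Y);
     idm := fun X => idm (sval X);
     comp := fun X Y Z g f => comp g f;
     comp_idl := fun X Y f => comp_idl f;
     comp_idr := fun X Y f => comp_idr f;
     compA := fun X Y Z W h g f => compA h g f |}.

Definition connective_structure (T : Type) (k : set (set T)) : Prop :=
  k set0 /\
  forall A : set (set T), A `<=` k -> A !=set0 ->
    \bigcap_(K in A) K !=set0 -> k (\bigcup_(K in A) K).

Record conn_space := ConnSpace {
  carrier :> Type;
  kappa : set (set carrier);
  kappaP : connective_structure kappa }.

Definition integral (X : conn_space) : Prop := forall x : X, kappa [set x].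

Definition connective_map (X Y : conn_space) (f : X -> Y) : Prop :=
  forall K, kappa K -> kappa (f @` K).

Record conn_morphism (X Y : conn_space) := ConnMorphism {
  conn_fun :> X -> Y;
  conn_funP : connective_map conn_fun }.

Definition component (X : conn_space) (F : set X) : Prop :=
  [/\ kappa F, F !=set0 &
      forall K : set X, kappa K -> K !=set0 -> F `<=` K -> K = F].

(* The smallest connective structure containing [A], written [A]_0; [smallest]
   is an intersection, itself connective by [generated_connective]. *)
Definition generated (T : Type) (A : set (set T)) : set (set T) :=
  smallest (@connective_structure T) A.

Lemma conn_morphism_eq (X Y : conn_space) (f g : conn_morphism X Y) :
  (forall x, f x = g x) -> f = g.
Proof.
case: f g => [f fP] [g gP] /= /funext fg; move: fP gP.
by rewrite fg => fP gP; congr ConnMorphism; exact: Prop_irrelevance.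
Qed.

Lemma connective_map_id (X : conn_space) : connective_map (@id X).
Proof. by move=> K; rewrite image_id. Qed.

Lemma connective_map_comp (X Y Z : conn_space) (g : Y -> Z) (f : X -> Y) :
  connective_map g -> connective_map f -> connective_map (g \o f).
Proof. by move=> gP fP K /fP /gP; rewrite image_comp. Qed.

Definition conn_id (X : conn_space) : conn_morphism X X :=
  ConnMorphism (@connective_map_id X).

Definition conn_comp (X Y Z : conn_space)
    (g : conn_morphism Y Z) (f : conn_morphism X Y) : conn_morphism X Z :=
  ConnMorphism (connective_map_comp (conn_funP g) (conn_funP f)).

Lemma generated_connective (T : Type) (A : set (set T)) :
  connective_structure (generated A).
Proof.
split=> [k [[]]//|B BA B0 BI k [kP Ak]].
by apply: kP.2 => // K /BA; apply.
Qed.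

Lemma generated_image (T U : Type) (f : T -> U)
    (A : set (set T)) (B : set (set U)) :
  (forall K, A K -> generated B (f @` K)) ->
  forall K, generated A K -> generated B (f @` K).
Proof.
move=> fAB K; apply: (smallest_sub (X := fun L => generated B (f @` L))) => //.
have [g0 gU] := generated_connective B.
split=> [|C CB [K0 CK0] [x xC]]; first by rewrite image_set0.
rewrite image_bigcup -(bigcup_image C (fun L => f @` L) id).
apply: gU => [_ [L /CB ? <-//]||]; first by exists (f @` K0), K0.
by exists (f x) => _ [L CL <-]; exists x => //; exact: xC.
Qed.

Lemma connective_bigcup_touching (T I : Type) (k : set (set T))
    (U : set T) (P : set I) (F : I -> set T) :
  connective_structure k -> k U ->
  (forall i, P i -> k (F i)) -> (forall i, P i -> U `&` F i !=set0) ->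
  U `<=` \bigcup_(i in P) F i -> k (\bigcup_(i in P) F i).
Proof.
move=> kP KU KF UF sU.
have [[i0 Pi0]|P0] := pselect (P !=set0); last first.
  suff -> : \bigcup_(i in P) F i = set0 by exact: kP.1.
  by apply/seteqP; split=> // x [i Pi _]; case: P0; exists i.
have -> : \bigcup_(i in P) F i =
          \bigcup_(K in [set U `|` F i | i in P]) K.
  rewrite bigcup_image; apply/seteqP; split=> x.
    by move=> [i Pi Fx]; exists i => //; right.
  by move=> [i Pi [/sU//|Fx]]; exists i.
apply: kP.2.
- move=> _ [i Pi <-].
  have -> : U `|` F i = \bigcup_(K in [set U; F i]) K.
    by rewrite bigcup_setU !bigcup_set1.
  apply: kP.2; first by move=> _ [->|->]; [|exact: KF].
    by exists U; left.
  by have [x [Ux Fx]] := UF _ Pi0; have [y [Uy Fy]] := UF _ Pi;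
    exists y => _ [->|->].
- by exists (U `|` F i0), i0.
- by have [x [Ux _]] := UF _ Pi0; exists x => _ [i _ <-]; left.
Qed.

Lemma component_unique (X : conn_space) (F G : set X) (x : X) :
  component F -> component G -> F x -> G x -> F = G.
Proof.
move=> [kF F0 Fmax] [kG G0 Gmax] Fx Gx.
have kFG : kappa (F `|` G).
  have -> : F `|` G = \bigcup_(K in [set F; G]) K.
    by rewrite bigcup_setU !bigcup_set1.
  apply: (kappaP X).2; first by move=> _ [->|->].
    by exists F; left.
  by exists x => _ [->|->].
have FG0 : F `|` G !=set0 by exists x; left.
by rewrite -(Fmax _ kFG FG0 (@subsetUl _ F G)) (Gmax _ kFG FG0 (@subsetUr _ F G)).
Qed.

Lemma component_exists (X : conn_space) (K : set X) :
  kappa K -> K !=set0 -> exists F, component F /\ K `<=` F.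
Proof.
move=> kK [x Kx]; pose C := [set L | kappa L /\ L x].
have Cx : (\bigcup_(L in C) L) x by exists K.
exists (\bigcup_(L in C) L); split; last by move=> y Ky; exists K.
split; first 1 last.
- by exists x.
- move=> L kL _ CL; apply/seteqP; split=> // y Ly; exists L => //.
  by split=> //; exact: CL.
apply: (kappaP X).2 => [L []//||]; first by exists K.
by exists x => L [].
Qed.

Record representation := Representation {
  ob : conn_space;
  sp : conn_space;
  rep :> ob -> set sp;
  rep_nonempty : forall a, rep a !=set0;
  rep_connected : forall K : set ob,
    kappa K -> kappa (\bigcup_(a in K) rep a) }.

Definition clear (rho : representation) : Prop :=
  forall S : set (ob rho), ~ kappa S -> ~ kappa (\bigcup_(a in S) rho a).

Definition distinct (rho : representation) : Prop :=
  forall a a' : ob rho, a <> a' -> rho a `&` rho a' = set0.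

Record rep_morphism (rho rho' : representation) := RepMorphism {
  mor_ob : conn_morphism (ob rho) (ob rho');
  mor_sp : conn_morphism (sp rho) (sp rho');
  mor_rep : forall a, mor_sp @` (rho a) `<=` rho' (mor_ob a) }.

Lemma rep_morphism_eq (rho rho' : representation) (f g : rep_morphism rho rho') :
  (forall a, mor_ob f a = mor_ob g a) -> (forall b, mor_sp f b = mor_sp g b) ->
  f = g.
Proof.
case: f g => [f0 f1 fP] [g0 g1 gP] /= /conn_morphism_eq e0 /conn_morphism_eq e1.
move: fP gP; rewrite e0 e1 => fP gP.
by congr RepMorphism; exact: Prop_irrelevance.
Qed.

Definition rep_id (rho : representation) : rep_morphism rho rho.
Proof.
by apply: (@RepMorphism _ _ (conn_id _) (conn_id _)) => a /=; rewrite image_id.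
Defined.

Definition rep_comp (r1 r2 r3 : representation)
  (g : rep_morphism r2 r3) (f : rep_morphism r1 r2) : rep_morphism r1 r3.
Proof.
apply: (@RepMorphism _ _ (conn_comp (mor_ob g) (mor_ob f))
                         (conn_comp (mor_sp g) (mor_sp f))) => a /=.
by move=> _ [b ab <-]; apply: mor_rep; exists (mor_sp f b) => //;
  apply: mor_rep; exists b.
Defined.

Definition Rep : category.
Proof.
apply: (@Category representation rep_morphism rep_id rep_comp).
- by move=> X Y f; exact: rep_morphism_eq.
- by move=> X Y f; exact: rep_morphism_eq.
- by move=> X Y Z W h g f; exact: rep_morphism_eq.
Defined.

Definition RIO : category :=
  @full_subcategory Rep
    (fun rho : representation => [/\ clear rho, distinct rho & integral (ob rho)]).

Record foliation := Foliation {
  support : Type;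
  kappa0 : set (set support);
  kappa1 : set (set support);
  kappa0P : connective_structure kappa0;
  kappa1P : connective_structure kappa1 }.

Definition internal (Z : foliation) : conn_space := ConnSpace (@kappa0P Z).
Definition external (Z : foliation) : conn_space := ConnSpace (@kappa1P Z).

Definition regular (Z : foliation) : Prop := @kappa0 Z `<=` @kappa1 Z.

Record fol_morphism (Z Z' : foliation) := FolMorphism {
  fol_fun :> support Z -> support Z';
  fol_fun0 : @connective_map (internal Z) (internal Z') fol_fun;
  fol_fun1 : @connective_map (external Z) (external Z') fol_fun }.

Lemma fol_morphism_eq (Z Z' : foliation) (f g : fol_morphism Z Z') :
  (forall x, f x = g x) -> f = g.
Proof.
case: f g => [f f0 f1] [g g0 g1] /= /funext fg; move: f0 f1 g0 g1.
by rewrite fg => *; congr FolMorphism; exact: Prop_irrelevance.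
Qed.

Definition fol_id (Z : foliation) : fol_morphism Z Z :=
  FolMorphism (@connective_map_id (internal Z)) (@connective_map_id (external Z)).

Definition fol_comp (Z1 Z2 Z3 : foliation)
    (g : fol_morphism Z2 Z3) (f : fol_morphism Z1 Z2) : fol_morphism Z1 Z3 :=
  FolMorphism (connective_map_comp (fol_fun0 g) (fol_fun0 f))
              (connective_map_comp (fol_fun1 g) (fol_fun1 f)).

Definition Fol : category.
Proof.
apply: (@Category foliation fol_morphism fol_id fol_comp).
- by move=> X Y f; exact: fol_morphism_eq.
- by move=> X Y f; exact: fol_morphism_eq.
- by move=> X Y Z W h g f; exact: fol_morphism_eq.
Defined.

Definition FR : category := @full_subcategory Fol regular.

Definition leaf (Z : foliation) : Type :=
  {F : set (internal Z) | component F}.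

Definition leaf_set (Z : foliation) (F : leaf Z) : set (support Z) := sval F.

Lemma leaf_eq (Z : foliation) (F G : leaf Z) (x : support Z) :
  leaf_set F x -> leaf_set G x -> F = G.
Proof.
case: F G => [F FP] [G GP]; rewrite /leaf_set /= => Fx Gx.
have e := component_unique FP GP Fx Gx; move: FP GP; rewrite e => FP GP.
by congr exist; exact: Prop_irrelevance.
Qed.

Definition leaf_kappa (Z : foliation) : set (set (leaf Z)) :=
  [set A | kappa1 (\bigcup_(F in A) leaf_set F)].

Lemma leaf_kappaP (Z : foliation) : connective_structure (@leaf_kappa Z).
Proof.
split; rewrite /leaf_kappa /=.
  by rewrite bigcup_set0; exact: (kappa1P Z).1.
move=> A Ak [L0 AL0] [F FA].
rewrite bigcup_bigcup.
rewrite -(bigcup_image A (fun L => \bigcup_(G in L) leaf_set G) id).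
apply: (kappa1P Z).2.
- by move=> _ [L AL <-]; exact: Ak.
- by exists (\bigcup_(G in L0) leaf_set G), L0.
- have [_ [x Fx] _] := svalP F.
  by exists x => _ [L AL <-]; exists F => //; exact: FA.
Qed.

Definition leaf_space (Z : foliation) : conn_space :=
  ConnSpace (@leaf_kappaP Z).

Definition leaf_rep (Z : foliation) : representation.
Proof.
apply: (@Representation (leaf_space Z) (external Z) (@leaf_set Z)).
- by move=> F; have [] := svalP F.
- by [].
Defined.

Lemma leaf_rep_RIO (Z : foliation) : regular Z ->
  [/\ clear (leaf_rep Z), distinct (leaf_rep Z) & integral (ob (leaf_rep Z))].
Proof.
move=> Zreg; split=> //.
  move=> F G FG; apply/seteqP; split=> // x [Fx Gx].
  by case: FG; exact: leaf_eq Fx Gx.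
move=> F; rewrite /= /leaf_kappa /= bigcup_set1; apply: Zreg.
by have [] := svalP F.
Qed.

Lemma leaf_image_exists (Z Z' : foliation) (phi : fol_morphism Z Z')
    (F : leaf Z) :
  exists F' : leaf Z', phi @` leaf_set F `<=` leaf_set F'.
Proof.
have [kF [x Fx] _] := svalP F.
have nphiF : phi @` leaf_set F !=set0 by exists (phi x), x.
have [F' [F'P FF']] :=
  @component_exists (internal Z') _ (fol_fun0 phi kF) nphiF.
by exists (exist _ F' F'P).
Qed.

(* The choice made by [cid] is irrelevant, by [leaf_imageE]. *)
Definition leaf_image (Z Z' : foliation) (phi : fol_morphism Z Z')
    (F : leaf Z) : leaf Z' :=
  sval (cid (leaf_image_exists phi F)).

Lemma leaf_imageP (Z Z' : foliation) (phi : fol_morphism Z Z') (F : leaf Z) :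
  phi @` leaf_set F `<=` leaf_set (leaf_image phi F).
Proof. exact: svalP (cid (leaf_image_exists phi F)). Qed.

Lemma leaf_imageE (Z Z' : foliation) (phi : fol_morphism Z Z')
    (F : leaf Z) (F' : leaf Z') :
  phi @` leaf_set F `<=` leaf_set F' -> leaf_image phi F = F'.
Proof.
move=> FF'; have [_ [x Fx] _] := svalP F.
have phix : (phi @` leaf_set F) (phi x) by exists x.
exact: leaf_eq (leaf_imageP phix) (FF' _ phix).
Qed.

Lemma leaf_image_connective (Z Z' : foliation) (phi : fol_morphism Z Z') :
  regular Z' ->
  @connective_map (leaf_space Z) (leaf_space Z') (leaf_image phi).
Proof.
move=> Z'reg A kA; rewrite /= /leaf_kappa /= bigcup_image.
apply: (connective_bigcup_touching (kappa1P Z') (fol_fun1 phi kA)).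
- by move=> F _; apply: Z'reg; have [] := svalP (leaf_image phi F).
- move=> F AF; have [_ [x Fx] _] := svalP F.
  exists (phi x); split; first by exists x => //; exists F.
  by apply: leaf_imageP; exists x.
- move=> _ [x [F AF Fx] <-]; exists F => //.
  by apply: leaf_imageP; exists x.
Qed.

Definition leaf_mor (Z Z' : foliation) (Z'reg : regular Z')
    (phi : fol_morphism Z Z') : rep_morphism (leaf_rep Z) (leaf_rep Z') :=
  @RepMorphism (leaf_rep Z) (leaf_rep Z')
    (ConnMorphism (@leaf_image_connective Z Z' phi Z'reg))
    (@ConnMorphism (external Z) (external Z') phi (fol_fun1 phi))
    (@leaf_imageP Z Z' phi).

Definition Rdown : functor FR RIO.
Proof.
apply: (@Functor FR RIO
  (fun Z => exist _ (leaf_rep (sval Z)) (leaf_rep_RIO (svalP Z)))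
  (fun Z Z' phi => leaf_mor (svalP Z') phi)).
- move=> Z; apply: rep_morphism_eq => //= F.
  by apply: leaf_imageE; rewrite image_id.
- move=> Z1 Z2 Z3 g f; apply: rep_morphism_eq => //= F.
  apply: leaf_imageE => /= _ [x Fx <-].
  apply: leaf_imageP; exists (fol_fun f x) => //.
  by apply: leaf_imageP; exists x.
Defined.

Definition Phi_internal (rho : representation) : set (set (sp rho)) :=
  generated (\bigcup_a [set K | kappa K /\ K `<=` rho a]).

Definition Phi_foliation (rho : representation) : foliation :=
  @Foliation (sp rho) (@Phi_internal rho) (@kappa (sp rho))
    (@generated_connective _ _) (kappaP (sp rho)).

Lemma Phi_regular (rho : representation) : regular (Phi_foliation rho).
Proof.
by apply: smallest_sub; [exact: kappaP|move=> K [a _ []]].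
Qed.

Lemma Phi_internal_map (rho rho' : representation) (f : rep_morphism rho rho') :
  @connective_map (internal (Phi_foliation rho)) (internal (Phi_foliation rho'))
    (mor_sp f).
Proof.
apply: generated_image => K [a _ [kK Ka]]; apply: sub_gen_smallest.
exists (mor_ob f a) => //; split; first exact: (conn_funP (mor_sp f)).
by apply: subset_trans (@mor_rep _ _ f a); exact: image_subset.
Qed.

Definition Phi_mor (rho rho' : representation) (f : rep_morphism rho rho') :
    fol_morphism (Phi_foliation rho) (Phi_foliation rho') :=
  @FolMorphism (Phi_foliation rho) (Phi_foliation rho') (mor_sp f)
    (@Phi_internal_map rho rho' f) (conn_funP (mor_sp f)).

Definition Phi_kappa : functor RIO FR.
Proof.
apply: (@Functor RIO FR
  (fun rho => exist _ (Phi_foliation (sval rho)) (@Phi_regular (sval rho)))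
  (fun rho rho' f => Phi_mor f)).
- by move=> rho; exact: fol_morphism_eq.
- by move=> r1 r2 r3 g f; exact: fol_morphism_eq.
Defined.

(* Main.v *)
From mathcomp Require Import all_boot.
From mathcomp Require Import boolp classical_sets.
Require Import Defs.

Set Implicit Arguments.
Unset Strict Implicit.
Unset Printing Implicit Defensive.

Local Open Scope classical_set_scope.

(** The adjunction bijection sends a morphism of representations
    [(alpha, beta)] from the leaves of [Z] to [rho] to its second component
    [beta], seen as a morphism of foliations from [Z] to [Phi_foliation rho];
    naturality then holds by definition.

    - [beta] is internally connective: a nonempty internally connected set lies
      in a leaf [F], so its image is a connected subset of [rho (alpha F)]
      ([transpose_internal]).
    - [alpha] is determined by [beta]: the nonempty set [beta F] can meet only
      one of the pairwise disjoint sets [rho a] ([transpose_inj]).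
    - Every [beta] arises: as [rho] is distinct, a nonempty connected set of the
      generated internal structure lies in a single [rho a]
      ([Phi_internal_subset_rep]), which gives [alpha F] from [beta F].  If a set
      of leaves is connected, with union [U], then the union of the corresponding
      sets [rho (alpha F)] is connected, since each of them is connected (the
      object of [rho] is integral) and meets the connected set [beta U];
      clearness of [rho] brings this connectedness back to the object of [rho]
      ([leaf_assignment_connective]). *)

Lemma distinct_inj (rho : representation) (a a' : ob rho) (b : sp rho) :
  distinct rho -> rho a b -> rho a' b -> a = a'.
Proof.
move=> rhoD ab a'b; apply: contrapT => /rhoD aa'.
have : (rho a `&` rho a') b by [].
by rewrite aa'.
Qed.

(** The sets that are empty or contained in a single [rho a] form a connective
    structure when [rho] is distinct, and it contains the generators of
    [Phi_internal rho]. *)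
Lemma Phi_internal_subset_rep (rho : representation) (K : set (sp rho)) :
  distinct rho -> Phi_internal K -> K !=set0 -> exists a, K `<=` rho a.
Proof.
move=> rhoD; pose P (L : set (sp rho)) := L !=set0 -> exists a, L `<=` rho a.
apply: (smallest_sub (X := P)) => [|L [a _ [_ La]] _]; last by exists a.
split=> [[x []]|A AP [L0 AL0] [x xA] _].
have [a L0a] : exists a, L0 `<=` rho a.
  by apply: AP => //; exists x; exact: xA.
exists a => y [L AL Ly].
have [a' La'] : exists a', L `<=` rho a' by apply: AP => //; exists y.
by rewrite (distinct_inj rhoD (L0a _ (xA _ AL0)) (La' _ (xA _ AL))); exact: La'.
Qed.

Section Transpose.
Variables (Z : foliation) (rho : representation).
Hypothesis Zreg : regular Z.

Lemma transpose_internal (f : rep_morphism (leaf_rep Z) rho) :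
  @connective_map (internal Z) (internal (Phi_foliation rho)) (mor_sp f).
Proof.
move=> K kK; have [->|/set0P K0] := eqVneq K set0.
  by rewrite image_set0; exact: (kappa0P (Phi_foliation rho)).1.
have [F [FP KF]] := @component_exists (internal Z) K kK K0.
apply: sub_gen_smallest; exists (mor_ob f (exist _ F FP)) => //; split.
  by apply: (conn_funP (mor_sp f)); exact: Zreg.
by apply: subset_trans (@mor_rep _ _ f (exist _ F FP)); exact: image_subset.
Qed.

(** The adjunct of a morphism of representations out of the leaves of [Z]. *)
Definition transpose (f : rep_morphism (leaf_rep Z) rho) :
    fol_morphism Z (Phi_foliation rho) :=
  @FolMorphism Z (Phi_foliation rho) (mor_sp f)
    (transpose_internal f) (conn_funP (mor_sp f)).

Lemma transpose_inj : distinct rho -> injective transpose.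
Proof.
move=> rhoD f g fg.
have fgE b : mor_sp f b = mor_sp g b.
  exact: (congr1 (@fol_fun Z (Phi_foliation rho) ^~ b) fg).
apply: rep_morphism_eq => // F; have [x Fx] := rep_nonempty F.
apply: (distinct_inj (b := mor_sp f x)) => //.
  by apply: mor_rep; exists x.
by rewrite fgE; apply: mor_rep; exists x.
Qed.

Lemma leaf_assignment_connective (f : fol_morphism Z (Phi_foliation rho))
    (alpha : leaf Z -> ob rho) :
  clear rho -> integral (ob rho) ->
  (forall F, f @` leaf_set F `<=` rho (alpha F)) ->
  @connective_map (leaf_space Z) (ob rho) alpha.
Proof.
move=> rhoC rhoI falpha A kA; apply: contrapT => /rhoC; apply.
rewrite bigcup_image.
apply: (connective_bigcup_touching (kappaP (sp rho)) (fol_fun1 f kA)).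
- move=> F _; rewrite -[X in kappa X](bigcup_set1 (@rep rho)).
  exact: rep_connected.
- move=> F AF; have [_ [x Fx] _] := svalP F.
  exists (f x); split; first by exists x => //; exists F.
  by apply: falpha; exists x.
- by move=> _ [x [F AF Fx] <-]; exists F => //; apply: falpha; exists x.
Qed.

Lemma transpose_surj : clear rho -> distinct rho -> integral (ob rho) ->
  forall g, exists f, transpose f = g.
Proof.
move=> rhoC rhoD rhoI g.
have /choice [alpha galpha] (F : leaf Z) :
    exists a, g @` leaf_set F `<=` rho a.
  have [kF [x Fx] _] := svalP F.
  by apply: Phi_internal_subset_rep (fol_fun0 g kF) _ => //; exists (g x), x.
exists (@RepMorphism (leaf_rep Z) rho
  (ConnMorphism (leaf_assignment_connective rhoC rhoI galpha))
  (@ConnMorphism (external Z) (sp rho) g (fol_fun1 g)) galpha).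
exact: fol_morphism_eq.
Qed.

Lemma transpose_bij : clear rho -> distinct rho -> integral (ob rho) ->
  bijective transpose.
Proof.
move=> rhoC rhoD rhoI.
have /choice [inv invK] := transpose_surj rhoC rhoD rhoI.
by exists inv => // f; apply: transpose_inj => //; rewrite invK.
Qed.

End Transpose.

Theorem mainTheorem1 : left_adjoint Rdown Phi_kappa.
Proof.
exists (fun (Z : FR) (rho : RIO) => @transpose (sval Z) (sval rho) (svalP Z)).
split=> [Z rho|Z Z' rho rho' h k f]; last exact: fol_morphism_eq.
by have [rhoC rhoD rhoI] := svalP rho; exact: transpose_bij.
Qed.
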